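(* Let $\mu=\sum_{i=1}^{n}a_{i}\delta_{x_{i}}$ and $\nu=\sum_{j=1}^{m}b_{j}\delta_{y_{j}}$ be discrete probability measures on $\mathbb{R}^{d}$ with $a_{i},b_{j}>0$ and $\sum_{i=1}^{n}a_{i}=\sum_{j=1}^{m}b_{j}=1$, and let $\gamma\in\mathscr{P}(\mathbb{R}^{d}\times\mathbb{R}^{d})$ be absolutely continuous with respect to the Lebesgue measure. For $\lambda>2$ let $$U_{\lambda}(\alpha,\beta)=\sum_{i=1}^{n}a_{i}\Bigl(\alpha_{i}+\tfrac12\|x_{i}\|^{2}\Bigr)+\sum_{j=1}^{m}b_{j}\Bigl(\beta_{j}+\tfrac12\|y_{j}\|^{2}\Bigr)-\int\phi_{\lambda}(x,\alpha)\,\psi_{\lambda}(y,\beta)\,\mathrm{d}\tilde\gamma+1.$$ Then the regularized problem $\sup_{(\alpha,\beta)\in\mathbb{R}^{n+m}}U_{\lambda}(\alpha,\beta)$ has a unique optimizer $(\alpha^{\lambda},\beta^{\lambda})$ in $\mathbb{R}^{n+m}_{\oplus}$. Moreover, $$\lim_{\lambda\to\infty}\|(\alpha^{\lambda},\beta^{\lambda})-(\alpha^{*},\beta^{*})\|_{l^{\infty}_{\oplus}}=0,$$ where $(\alpha^{*},\beta^{*})$ is the optimizer of the unregularized dual problem $\sup_{(\alpha,\beta)}U(\alpha,\beta)$.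
   Context: $\tilde\gamma(\mathrm{d}x,\mathrm{d}y)=\exp(-\tfrac12\|x\|^{2}-\tfrac12\|y\|^{2})\gamma(\mathrm{d}x,\mathrm{d}y)$. For $(\alpha,\beta)\in\mathbb{R}^{n}\times\mathbb{R}^{m}$, $$\phi_{\lambda}(x,\alpha)=\Bigl(\sum_{i=1}^{n}\exp(\lambda\langle x,x_{i}\rangle+\lambda\alpha_{i})\Bigr)^{1/\lambda},\qquad\psi_{\lambda}(y,\beta)=\Bigl(\sum_{j=1}^{m}\exp(\lambda\langle y,y_{j}\rangle+\lambda\beta_{j})\Bigr)^{1/\lambda}.$$ With $f(x,\alpha)=\sup_{1\le i\le n}\{\langle x,x_{i}\rangle+\alpha_{i}\}$ and $g(y,\beta)=\sup_{1\le j\le m}\{\langle y,y_{j}\rangle+\beta_{j}\}$, the unregularized dual objective is $$U(\alpha,\beta)=\sum_{i=1}^{n}a_{i}\Bigl(\alpha_{i}+\tfrac12\|x_{i}\|^{2}\Bigr)+\sum_{j=1}^{m}b_{j}\Bigl(\beta_{j}+\tfrac12\|y_{j}\|^{2}\Bigr)-\int\exp\bigl(f(x,\alpha)+g(y,\beta)\bigr)\mathrm{d}\tilde\gamma+1,$$ and $(\alpha^{*},\beta^{*})$ is its maximizer, which in the paper is the unique one in $\mathbb{R}^{n+m}_{\oplus}$. $(\alpha^{1},\beta^{1})\sim_{\oplus}(\alpha^{2},\beta^{2})$ if there is $r\in\mathbb{R}$ with $\alpha^{1}=\alpha^{2}+r\mathbf{1}$, $\beta^{1}=\beta^{2}-r\mathbf{1}$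 ($\mathbf{1}$ the all-ones vector); $\mathbb{R}^{n+m}_{\oplus}=\mathbb{R}^{n+m}/{\sim_{\oplus}}$ with norm $\|(\alpha,\beta)\|_{l^{\infty}_{\oplus}}=\max_{i,j}|\alpha_{i}+\beta_{j}|$. *)

(* Defs.v *)
From HB Require Import structures.
From mathcomp Require Import all_boot all_order all_algebra.
From mathcomp Require Import all_classical all_reals all_analysis.
From mathcomp Require Import measurable_realfun ring.

Set Implicit Arguments.
Unset Strict Implicit.
Unset Printing Implicit Defensive.
Import Order.TTheory GRing.Theory Num.Theory.
Import numFieldNormedType.Exports.
Local Open Scope classical_set_scope.
Local Open Scope ring_scope.

(* R^d is d.-tuple R with its product sigma-algebra (which is the Borel one);
   R^n x R^m, where (alpha, beta) lives, is 'rV[R]_n * 'rV[R]_m. *)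

Section lebesgue_tuple.
Context {R : realType}.
Local Open Scope ereal_scope.

Definition tcons n (p : R * n.-tuple R) : n.+1.-tuple R :=
  [tuple of p.1 :: p.2].

Lemma measurable_tcons n : measurable_fun [set: R * n.-tuple R] (@tcons n).
Proof. exact: measurable_cons. Qed.

(* Lebesgue measure on R^n, as the n-fold product of lebesgue_measure *)
Fixpoint lebesgue_tuple n : set (n.-tuple R) -> \bar R :=
  match n with
  | 0 => \d_ ([tuple] : 0.-tuple R)
  | k.+1 => pushforward (lebesgue_measure \x @lebesgue_tuple k) (@tcons k)
  end.

Let tuncons n (t : n.+1.-tuple R) : R * n.-tuple R :=
  (tnth t ord0, [tuple of behead t]).

Let measurable_tuncons n : measurable_fun [set: n.+1.-tuple R] (@tuncons n).
Proof.
by apply: measurable_fun_pair; [exact: measurable_tnth|exact: measurable_behead].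
Qed.

Let tconsK n : cancel (@tcons n) (@tuncons n).
Proof. by move=> [x t]; congr pair; exact/val_inj. Qed.

Let tunconsK n : cancel (@tuncons n) (@tcons n).
Proof. by move=> t; rewrite /tcons /tuncons/= [RHS]tuple_eta; exact/val_inj. Qed.

Section step.
Variables (n : nat) (m : {sigma_finite_measure set (n.-tuple R) -> \bar R}).

Let push := pushforward (lebesgue_measure \x m) (@tcons n).

Let push0 : push set0 = 0.
Proof. by rewrite /push /pushforward preimage_set0 measure0. Qed.

Let push_ge0 A : 0 <= push A.
Proof. exact: (@measure_ge0 _ _ _ (lebesgue_measure \x m)). Qed.

Let push_sigma_additive : semi_sigma_additive push.
Proof.
move=> F mF tF _; have mF' k : measurable (@tcons n @^-1` F k).
  by rewrite -[X in measurable X]setTI; exact: measurable_tcons.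
rewrite /push /pushforward preimage_bigcup.
apply: measure_semi_sigma_additive => //; last exact: bigcupT_measurable.
apply/trivIsetP => /= i j _ _ ij; rewrite -preimage_setI.
by move/trivIsetP : tF => /(_ _ _ _ _ ij) ->//; rewrite preimage_set0.
Qed.

HB.instance Definition _ := isMeasure.Build _ _ _ push
  push0 push_ge0 push_sigma_additive.

Let push_sigma_finite : sigma_finite setT push.
Proof.
have /sigma_finiteP[F [TF ndF Foo]] := sigma_finiteT (@lebesgue_measure R).
have /sigma_finiteP[G [TG ndG Goo]] := sigma_finiteT m.
exists (fun i => @tuncons n @^-1` (F i `*` G i)).
  rewrite -preimage_bigcup (_ : \bigcup_i _ = setT) ?preimage_setT//.
  rewrite -setXTT TF TG; apply/seteqP; split=> -[u t].
    by move=> [i _ []/= ? ?]; split; exists i.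
  move=> [/= [i _ Fu] [k _ Gt]]; exists (maxn i k) => //; split.
  - by move: u Fu; exact/subsetPset/ndF/leq_maxl.
  - by move: t Gt; exact/subsetPset/ndG/leq_maxr.
move=> i; have [? ?] := Foo i; have [? ?] := Goo i; split.
  rewrite -[X in measurable X]setTI; apply: measurable_tuncons => //.
  exact: measurableX.
rewrite /push /pushforward -comp_preimage.
rewrite (_ : _ \o _ = id); last by apply/funext => p /=; rewrite tconsK.
by rewrite preimage_id product_measure1E// lte_mul_pinfty// ge0_fin_numE.
Qed.

HB.instance Definition _ :=
  Measure_isSigmaFinite.Build _ _ _ push push_sigma_finite.

Definition tcons_measure : {sigma_finite_measure set _ -> \bar R} := push.

End step.

Let lebesgue_tuple_package n :
  exists m : {sigma_finite_measure set (n.-tuple R) -> \bar R},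
    m = @lebesgue_tuple n :> (set _ -> _).
Proof.
elim: n => [|n [m mE]]; first by exists (\d_ ([tuple] : 0.-tuple R)).
by exists (tcons_measure m); rewrite /= -mE.
Qed.

Section instances.
Variable n : nat.
Local Notation leb := (@lebesgue_tuple n).

Let leb0 : leb set0 = 0.
Proof. by have [m <-] := lebesgue_tuple_package n; exact: measure0. Qed.

Let leb_ge0 A : 0 <= leb A.
Proof. by have [m <-] := lebesgue_tuple_package n; exact: measure_ge0. Qed.

Let leb_sigma_additive : semi_sigma_additive leb.
Proof.
by have [m <-] := lebesgue_tuple_package n; exact: measure_semi_sigma_additive.
Qed.

HB.instance Definition _ := isMeasure.Build _ _ _ leb
  leb0 leb_ge0 leb_sigma_additive.

Let leb_sigma_finite : sigma_finite setT leb.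
Proof. by have [m <-] := lebesgue_tuple_package n; exact: sigma_finiteT. Qed.

HB.instance Definition _ :=
  Measure_isSigmaFinite.Build _ _ _ leb leb_sigma_finite.

End instances.

Lemma lebesgue_tuple_box n (A : 'I_n -> set R) :
  (forall i, measurable (A i)) ->
  lebesgue_tuple [set t : n.-tuple R | forall i, A i (tnth t i)] =
  \prod_(i < n) lebesgue_measure (A i).
Proof.
elim: n A => [|n IHn] A mA.
  rewrite big_ord0 (_ : [set t | _] = setT); last first.
    by apply/seteqP; split=> // t _ [].
  exact: diracT.
rewrite big_ord_recl -IHn//= /pushforward.
set B := [set t : n.-tuple R | _].
have mB : measurable B.
  rewrite /B (_ : [set _ | _] = \bigcap_(i in [set: 'I_n])
      ((@tnth n R ^~ i) @^-1` A (lift ord0 i))); last first.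
    by apply/seteqP; split=> t h i; [move=> _|]; exact: h.
  apply: fin_bigcap_measurable => // i _.
  by rewrite -[X in measurable X]setTI; exact: measurable_tnth.
rewrite (_ : _ @^-1` _ = A ord0 `*` B); first
  (rewrite product_measure1E; [by []|exact: mA|exact: mB]).
apply/seteqP; split=> [[x t] /= h|[x t] /= [Ax Bt] i].
  split=> [|i]; first exact: (h ord0).
  by have := h (lift ord0 i); rewrite tnthS.
have [->//|] := eqVneq i ord0.
by case: (unliftP ord0 i) => [j ->|->]; rewrite ?eqxx// tnthS => _; exact: Bt.
Qed.

End lebesgue_tuple.
Arguments lebesgue_tuple {R} n _.

Section reweighted.
Context {R : realType} {d : nat}.

Definition dotp (u v : d.-tuple R) : R := \sum_(k < d) tnth u k * tnth v k.

Lemma measurable_dotp d' (T : measurableType d') (f g : T -> d.-tuple R) :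
  measurable_fun setT f -> measurable_fun setT g ->
  measurable_fun setT (fun z => dotp (f z) (g z)).
Proof.
move=> mf mg; apply: measurable_sum => k.
apply: measurable_funM.
  exact: (measurableT_comp (measurable_tnth _)).
exact: (measurableT_comp (measurable_tnth _)).
Qed.

Definition gauss_weight (z : d.-tuple R * d.-tuple R) : R :=
  expR (- (2^-1 * dotp z.1 z.1) - 2^-1 * dotp z.2 z.2).

Lemma measurable_gauss_weight : measurable_fun setT gauss_weight.
Proof.
apply: measurableT_comp => //; apply: measurable_funB.
  by apply: measurableT_comp => //; apply: measurable_funM => //; exact: measurable_dotp.
by apply: measurable_funM => //; exact: measurable_dotp.
Qed.

Variable gamma : probability (d.-tuple R * d.-tuple R)%type R.

(* tilde gamma(dx, dy) = exp(- |x|^2 / 2 - |y|^2 / 2) gamma(dx, dy) *)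
Definition gauss_reweight (A : set (d.-tuple R * d.-tuple R)) : \bar R :=
  (\int[gamma]_(z in A) (gauss_weight z)%:E)%E.

Let reweight0 : gauss_reweight set0 = 0%E.
Proof. by rewrite /gauss_reweight integral_set0. Qed.

Let reweight_ge0 A : (0 <= gauss_reweight A)%E.
Proof. by apply: integral_ge0 => z _; rewrite lee_fin expR_ge0. Qed.

Let reweight_sigma_additive : semi_sigma_additive gauss_reweight.
Proof.
move=> A mA tA mUA; rewrite /gauss_reweight ge0_integral_bigcup//.
- apply: is_cvg_ereal_nneg_natsum_cond => n _ _.
  by apply: integral_ge0 => z _; rewrite lee_fin expR_ge0.
- apply: measurable_funTS; apply/measurable_EFinP.
  exact: measurable_gauss_weight.
- by move=> z _; rewrite lee_fin expR_ge0.
Qed.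

HB.instance Definition _ := isMeasure.Build _ _ _ gauss_reweight
  reweight0 reweight_ge0 reweight_sigma_additive.

End reweighted.

Section dual.
Context {R : realType} {d n m : nat}.
Variables (a : 'I_n -> R) (b : 'I_m -> R).
Variables (x : 'I_n -> d.-tuple R) (y : 'I_m -> d.-tuple R).
Variable gamma : probability (d.-tuple R * d.-tuple R)%type R.

(* f (resp. g) for p := x, c := alpha (resp. p := y, c := beta) *)
Definition max_affine k (p : 'I_k -> d.-tuple R) (z : d.-tuple R)
    (c : 'rV[R]_k) : R :=
  sup [set dotp z (p i) + c 0 i | i in [set: 'I_k]].

(* likewise phi_lambda and psi_lambda *)
Definition soft_max_affine (lambda : R) k (p : 'I_k -> d.-tuple R)
    (z : d.-tuple R) (c : 'rV[R]_k) : R :=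
  (\sum_(i < k) expR (lambda * dotp z (p i) + lambda * c 0 i)) `^ lambda^-1.

Definition linear_part (ab : 'rV[R]_n * 'rV[R]_m) : R :=
  \sum_(i < n) a i * (ab.1 0 i + 2^-1 * dotp (x i) (x i)) +
  \sum_(j < m) b j * (ab.2 0 j + 2^-1 * dotp (y j) (y j)).

(* The real-valued integrals below are of nonnegative functions of at most
   exponential growth against a Gaussian-weighted measure, hence finite. *)
Definition dual_obj (ab : 'rV[R]_n * 'rV[R]_m) : R :=
  linear_part ab
  - (\int[gauss_reweight gamma]_z
       expR (max_affine x z.1 ab.1 + max_affine y z.2 ab.2))
  + 1.

Definition reg_dual_obj (lambda : R) (ab : 'rV[R]_n * 'rV[R]_m) : R :=
  linear_part ab
  - (\int[gauss_reweight gamma]_z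
       (soft_max_affine lambda x z.1 ab.1 * soft_max_affine lambda y z.2 ab.2))
  + 1.

End dual.

Section oplus.
Context {R : realType} {n m : nat}.
Implicit Types p q : 'rV[R]_n * 'rV[R]_m.

Definition oplus_equiv p q : Prop :=
  exists r : R, p.1 = q.1 + const_mx r /\ p.2 = q.2 - const_mx r.

(* 0 is neutral for the max of nonnegative numbers; on the quotient this is
   well defined by oplus_norm_equiv below *)
Definition oplus_norm p : R :=
  \big[Num.max/0]_(i < n) \big[Num.max/0]_(j < m) `|p.1 0 i + p.2 0 j|.

Lemma oplus_norm_equiv p p' q q' : oplus_equiv p p' -> oplus_equiv q q' ->
  oplus_norm (p - q) = oplus_norm (p' - q').
Proof.
move=> [r [p1 p2]] [s [q1 q2]]; apply: eq_bigr => i _; apply: eq_bigr => j _.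
rewrite /= p1 p2 q1 q2 !mxE; congr `|_|; ring.
Qed.

Definition is_maximizer (F : 'rV[R]_n * 'rV[R]_m -> R) p : Prop :=
  forall q, F q <= F p.

(* The class of p is the unique maximizer of F in the quotient by oplus_equiv:
   the maximizers of F are exactly the representatives of that class. *)
Definition is_unique_maximizer (F : 'rV[R]_n * 'rV[R]_m -> R) p : Prop :=
  forall q, is_maximizer F q <-> oplus_equiv q p.

End oplus.

(* Main.v *)
(* Write I_lambda for the integral term. Moving each coordinate by at most e
   changes phi_lambda psi_lambda by a factor at most exp(2 e), so log I_lambda
   is Lipschitz and no convergence theorem is needed for continuity. Since
   phi_lambda(x, alpha) >= exp(<x, x_i> + alpha_i), the objective is coercive in
   the sums alpha_i + beta_j, so it attains its supremum on a compact set of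
   normalized representatives; Cauchy-Schwarz makes phi_lambda psi_lambda
   strictly convex modulo the oplus relation.
   For the limit, exp f <= phi_lambda <= n^(1/lambda) exp f (and likewise for
   psi_lambda) gives
     U(p_lambda) >= U_lambda(p_lambda) >= U_lambda(pstar) --> U(pstar)
   for the optimizers p_lambda of U_lambda and pstar of U,
   so the regularized optimizers are maximizing for U, and by compactness a
   maximizing family of a coercive continuous function with a unique maximizer
   converges to it. *)

Require Import Defs.
From mathcomp Require Import all_boot all_order all_algebra.
From mathcomp Require Import all_classical all_reals all_analysis.
From mathcomp Require Import measurable_realfun lra ring.

Set Implicit Arguments.
Unset Strict Implicit.
Unset Printing Implicit Defensive.
Import Order.TTheory GRing.Theory Num.Theory.
Import numFieldNormedType.Exports.
Local Open Scope classical_set_scope.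
Local Open Scope ring_scope.

(** * Integrals against the Gaussian-weighted measure *)

(** A zero integral would put the whole space, where [f] never vanishes, inside a null set. *)
Lemma Rintegral_gt0 d (T : measurableType d) (R : realType)
    (mu : {measure set T -> \bar R}) (f : T -> R) :
  mu setT != 0%E -> mu.-integrable setT (EFin \o f) -> (forall t, 0 < f t) ->
  0 < \int[mu]_t f t.
Proof.
move=> mu0 fi f0; rewrite lt_neqAle Rintegral_ge0 ?andbT => [|t _]; last exact: ltW.
apply/eqP => int0.
have mf := measurable_int _ fi.
have : (\int[mu]_t `|(EFin \o f) t| = 0)%E.
  under eq_integral do rewrite gee0_abs ?lee_fin ?ltW//.
  have /fineK <- := integrable_fin_num measurableT fi.
  by congr EFin.
move/(ae_eq_integral_abs _ measurableT mf) => -[N [mN N0 sub]].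
move/eqP: mu0; apply; apply: (subset_measure0 _ mN _ N0) => // t _.
by apply: sub => /(_ I) /= [] ft0; move: (f0 t); rewrite ft0 ltxx.
Qed.

Section gauss_weight.
Context {R : realType} {d : nat}.
Local Notation T := (d.-tuple R * d.-tuple R)%type.
Variable gamma : probability T R.
Local Notation mu := (gauss_reweight gamma).

Lemma dotp_ge0 (u : d.-tuple R) : 0 <= dotp u u.
Proof. by apply: sumr_ge0 => k _; rewrite -expr2 sqr_ge0. Qed.

(** Sum of the squares of [u_k - v_k]; this lets the Gaussian weight absorb every exponential of a
    scalar product. *)
Lemma dotp_le (u v : d.-tuple R) :
  dotp u v <= 2^-1 * dotp u u + 2^-1 * dotp v v.
Proof.
rewrite /dotp !mulr_sumr -big_split /=; apply: ler_sum => k _.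
by have := sqr_ge0 (tnth u k - tnth v k); nra.
Qed.

Lemma gauss_weight_le1 (z : T) : gauss_weight z <= 1.
Proof.
by rewrite -expR0 ler_expR; have := dotp_ge0 z.1; have := dotp_ge0 z.2; lra.
Qed.

(** The total mass is the [gamma]-integral of a positive weight, and [gamma] has mass 1. *)
Lemma gauss_reweight_neq0 : mu setT != 0%E.
Proof.
rewrite gt_eqF //; have mw : measurable_fun setT (EFin \o @gauss_weight R d).
  by apply/measurable_EFinP; exact: measurable_gauss_weight.
have wi : gamma.-integrable setT (EFin \o @gauss_weight R d).
  have := finite_measure_integrable_cst gamma 1 measurableT.
  apply: le_integrable => // z _ /=.
  by rewrite lee_fin !ger0_norm ?expR_ge0// gauss_weight_le1.
have g0 : gamma setT != 0%E by rewrite probability_setT onee_eq0.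
have := Rintegral_gt0 g0 wi (fun z => expR_gt0 _).
by rewrite -lte_fin /Rintegral fineK //; exact: integrable_fin_num wi.
Qed.

(* On [k <= h < k + 1] the integral of [h] is at most (k + 1) times the
   reweighted mass, hence at most the gamma-integral of [(h + 1) w]. *)
Lemma gauss_reweight_integrable (h : T -> R) (C : R) :
  measurable_fun setT h -> (forall z, 0 <= h z) ->
  (forall z, h z * gauss_weight z <= C) -> mu.-integrable setT (EFin \o h).
Proof.
move=> mh h0 hC.
have mw : measurable_fun setT (@gauss_weight R d) := measurable_gauss_weight.
pose A k : set T := h @^-1` `[k%:R, k.+1%:R[.
have mA k : measurable (A k) by rewrite -[A k]setTI; exact: mh.
have tA : trivIset setT A.
  apply/trivIsetP => i j _ _ ij; apply/seteqP; split => // z [].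
  rewrite /A /= !in_itv /= => /andP[i1 i2] /andP[j1 j2].
  have := le_lt_trans i1 j2; have := le_lt_trans j1 i2.
  by rewrite !ltr_nat !ltnS => ji ij'; move: ij; rewrite eqn_leq ji ij'.
have UA : \bigcup_k A k = setT.
  apply/seteqP; split => // z _; exists (Num.truncn (h z)) => //.
  by rewrite /A /= in_itv /=; exact: truncn_itv.
apply/integrableP; split; first exact/measurable_EFinP.
under eq_integral do rewrite gee0_abs ?lee_fin//.
rewrite -UA ge0_integral_bigcup //; last 2 first.
- by rewrite UA; exact/measurable_EFinP.
- by move=> z _; rewrite lee_fin.
have AC k : (\int[mu]_(z in A k) (EFin \o h) z <= (C + 1)%:E * gamma (A k))%E.
  apply: (@le_trans _ _ (\int[mu]_(z in A k) (k.+1%:R)%:E)%E).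
    apply: ge0_le_integral => //.
    - by move=> z _; rewrite lee_fin.
    - by apply: measurable_funTS; exact/measurable_EFinP.
    - by move=> z; rewrite /A /= in_itv /= lee_fin => /andP[_ /ltW].
  rewrite integral_cst // [X in (_ * X)%E]/(mu (A k)) /= /gauss_reweight.
  rewrite -ge0_integralZl//; last 2 first.
  - by apply: measurable_funTS; exact/measurable_EFinP.
  - by move=> z _; rewrite lee_fin expR_ge0.
  rewrite -integral_cst //; apply: ge0_le_integral => //.
  - by move=> z _; rewrite lee_fin mulr_ge0 ?expR_ge0.
  - by apply: measurable_funTS; apply/measurable_EFinP; exact: measurable_funM.
  move=> z; rewrite /A /= in_itv /= lee_fin => /andP[kh _].
  (* On this piece [(k + 1) w <= (h + 1) w <= C + 1], since [h w <= C] and [w <= 1]. *)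
  have w0 : 0 <= gauss_weight z := expR_ge0 _.
  by have := gauss_weight_le1 z; have := hC z; rewrite -(natr1 k); nra.
have C0 : 0 <= C + 1.
  rewrite addr_ge0 //; apply: le_trans (hC ([tuple of nseq d 0], [tuple of nseq d 0])).
  by rewrite mulr_ge0 ?expR_ge0.
apply: (@le_lt_trans _ _ ((C + 1)%:E * \sum_(0 <= k <oo) gamma (A k))%E).
  rewrite -nneseriesZl //; apply: lee_nneseries => [k _ _|k _]; last exact: AC.
  by apply: integral_ge0 => z _; rewrite lee_fin.
have <- : gamma (\bigcup_k A k) = (\sum_(0 <= k <oo) gamma (A k))%E.
  by rewrite measure_bigcup //; apply: eq_eseriesl => k; rewrite in_setT.
by rewrite UA probability_setT mule1 ltry.
Qed.

End gauss_weight.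

(** * Finite maxima of affine functions *)

Section max_affine.
Context {R : realType} {d k : nat} (p : 'I_k -> d.-tuple R).
Implicit Types (z : d.-tuple R) (c : 'rV[R]_k) (i : 'I_k).

(** The index [i0] makes the set nonempty; on the empty set [sup] is 0 by default. *)
Lemma max_affine_le z c i0 (r : R) :
  (forall i, dotp z (p i) + c 0 i <= r) -> max_affine p z c <= r.
Proof.
move=> le_r; apply: ge_sup; first by exists (dotp z (p i0) + c 0 i0), i0.
by move=> _ [i _ <-].
Qed.

Lemma max_affineE z c i0 : max_affine p z c =
  \big[Num.max/dotp z (p i0) + c 0 i0]_i (dotp z (p i) + c 0 i).
Proof.
apply/le_anti/andP; split.
  by apply: (max_affine_le i0) => i; exact: le_bigmax.
have le_sup i : dotp z (p i) + c 0 i <= max_affine p z c.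
  apply: ub_le_sup; last by exists i.
  exists (\big[Num.max/dotp z (p i0) + c 0 i0]_j (dotp z (p j) + c 0 j)).
  by move=> _ [j _ <-]; exact: le_bigmax.
exact: bigmax_le.
Qed.

Lemma max_affine_ge z c i : dotp z (p i) + c 0 i <= max_affine p z c.
Proof. by rewrite (max_affineE _ _ i); exact: le_bigmax. Qed.

Lemma expR_max_affine_le z c i0 (M : R) :
  (forall i, expR (dotp z (p i) + c 0 i) <= M) -> expR (max_affine p z c) <= M.
Proof.
move=> leM; have M0 : M \is Num.pos by exact: lt_le_trans (expR_gt0 _) (leM i0).
rewrite -[M]lnK // ler_expR; apply: (max_affine_le i0) => i.
by rewrite -ler_expR lnK.
Qed.

Lemma measurable_max_affine i0 c : measurable_fun setT (fun z => max_affine p z c).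
Proof.
under eq_fun do rewrite (max_affineE _ _ i0).
have maff i : measurable_fun setT (fun z => dotp z (p i) + c 0 i).
  by apply: measurable_funD => //; exact: measurable_dotp.
elim: (index_enum _) => [|i s ihs].
  by under eq_fun do rewrite big_nil; exact: maff.
by under eq_fun do rewrite big_cons; exact: measurable_maxr.
Qed.

(** By [dotp_le] each exponential splits into a factor in [p i] and one in [z]; the sum over [i]
    dominates the maximum. *)
Lemma expR_max_affine0_le z i0 : expR (max_affine p z 0) <=
  (\sum_i expR (2^-1 * dotp (p i) (p i))) * expR (2^-1 * dotp z z).
Proof.
apply: (expR_max_affine_le i0) => i; rewrite mulr_suml (bigD1 i) //=.
rewrite -expRD ler_wpDr ?sumr_ge0//.
by rewrite mxE addr0 ler_expR addrC dotp_le.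
Qed.

End max_affine.

(** * Cauchy-Schwarz and log-convexity of [soft_max_affine] *)

(** With [P], [S], [Q] the three sums, [\sum_i (Q e_i - P f_i)^2 = Q (S Q - P^2)] and [Q > 0]: the
    sign of the left side gives the inequality, its vanishing the equality case. *)
Lemma cauchy_schwarz_sum (R : realFieldType) k (e f : 'I_k -> R) (i0 : 'I_k) :
  (forall i, 0 < f i) ->
  (\sum_i e i * f i) ^+ 2 <= (\sum_i e i ^+ 2) * (\sum_i f i ^+ 2)
  ?= iff [forall i, e i == (\sum_i e i * f i) / (\sum_i f i ^+ 2) * f i].
Proof.
move=> f0; set P := \sum_i _ * _; set S := \sum_i e i ^+ 2.
set Q := \sum_i f i ^+ 2.
have Q0 : 0 < Q.
  rewrite /Q (bigD1 i0) //= ltr_pwDl ?exprn_gt0//.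
  by apply: sumr_ge0 => i _; rewrite sqr_ge0.
have defect : \sum_i (Q * e i - P * f i) ^+ 2 = Q * (S * Q - P ^+ 2).
  rewrite (eq_bigr (fun i => Q ^+ 2 * e i ^+ 2 - 2 * Q * P * (e i * f i)
    + P ^+ 2 * f i ^+ 2)); last by move=> i _; ring.
  by rewrite big_split /= sumrB -!mulr_sumr -/P -/S -/Q; ring.
split.
  rewrite -subr_ge0 -(pmulr_rge0 _ Q0) -defect.
  by apply: sumr_ge0 => i _; rewrite sqr_ge0.
have -> : (P ^+ 2 == S * Q) = (\sum_i (Q * e i - P * f i) ^+ 2 == 0).
  by rewrite defect mulf_eq0 (gt_eqF Q0) /= subr_eq0 eq_sym.
rewrite psumr_eq0; last by move=> i _; rewrite sqr_ge0.
apply/allP/forallP => [h i|h i _].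
  have := h i (mem_index_enum _); rewrite /= sqrf_eq0 subr_eq0 => /eqP qe.
  by rewrite mulrAC -qe mulrAC mulfV ?mul1r // gt_eqF.
rewrite /= sqrf_eq0 subr_eq0 (eqP (h i)).
by rewrite 2!mulrA [Q * P]mulrC mulfK ?(gt_eqF Q0).
Qed.

Section soft_max_affine.
Context {R : realType} {d k : nat} (p : 'I_k -> d.-tuple R) (lambda : R).
Hypothesis lambda_gt0 : 0 < lambda.
Implicit Types (z : d.-tuple R) (c : 'rV[R]_k) (i : 'I_k).

Let S z c := \sum_(i < k) expR (lambda * dotp z (p i) + lambda * c 0 i).

Let S_ge0 z c : 0 <= S z c.
Proof. by apply: sumr_ge0 => i _; exact: expR_ge0. Qed.

Let root_le (s t : R) : 0 <= s -> s <= t -> s `^ lambda^-1 <= t `^ lambda^-1.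
Proof.
move=> s0 st; apply: ge0_ler_powR; rewrite ?nnegrE ?invr_ge0//.
- exact: ltW.
- exact: le_trans st.
Qed.

(** Strict monotonicity of the root carries equality back from the roots to [P], [A] and [B]. *)
Let root_sq_le (A B P : R) : 0 <= A -> 0 <= B -> 0 <= P -> P ^+ 2 <= A * B ->
  (P `^ lambda^-1) ^+ 2 <= A `^ lambda^-1 * B `^ lambda^-1 /\
  (A `^ lambda^-1 * B `^ lambda^-1 <= (P `^ lambda^-1) ^+ 2 -> P ^+ 2 = A * B).
Proof.
move=> A0 B0 P0 P_le; rewrite expr2 -!powRM// -expr2.
split; first by apply: root_le => //; exact: sqr_ge0.
rewrite leNgt => root_ge; apply/eqP; rewrite eq_le P_le leNgt.
apply: contra root_ge => P_lt.
by apply: gt0_ltr_powR; rewrite ?nnegrE ?invr_gt0 ?mulr_ge0.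
Qed.

(** The logarithm of [e c i = t * e c' i], with [l = ln t]: the scalar product [D] cancels, so the
    shift does not depend on the index. *)
Let half_log_eq (D u v l : R) :
  2^-1 * (lambda * D + lambda * u) = l + 2^-1 * (lambda * D + lambda * v) ->
  u = v + 2 * l / lambda.
Proof.
move=> uv; apply: (mulfI (lt0r_neq0 lambda_gt0)).
by rewrite mulrDr mulrCA mulfV ?lt0r_neq0// mulr1; lra.
Qed.

Let expR_root (u : R) : expR (lambda * u) `^ lambda^-1 = expR u.
Proof. by rewrite -expRM mulrAC mulfV ?mul1r// gt_eqF. Qed.

Lemma measurable_soft_max_affine c :
  measurable_fun setT (fun z => soft_max_affine lambda p z c).
Proof.
apply: (measurableT_comp (measurable_powR _)); apply: measurable_sum => i.
apply: measurableT_comp => //; apply: measurable_funD => //.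
by apply: measurable_funM => //; exact: measurable_dotp.
Qed.

Lemma expR_le_soft_max_affine z c i :
  expR (dotp z (p i) + c 0 i) <= soft_max_affine lambda p z c.
Proof.
rewrite -expR_root; apply: root_le; first exact: expR_ge0.
by rewrite mulrDr (bigD1 i) //= ler_wpDr ?sumr_ge0.
Qed.

(** A shift by [r] multiplies the sum by [expR (lambda * r)], whose root is [expR r] whatever
    [lambda]. *)
Lemma soft_max_affine_shift z c c' (r : R) : (forall i, c 0 i <= c' 0 i + r) ->
  soft_max_affine lambda p z c <= expR r * soft_max_affine lambda p z c'.
Proof.
move=> cc'; rewrite -expR_root -powRM ?expR_ge0// -/(S _ _); last exact: S_ge0.
apply: root_le; first exact: S_ge0.
rewrite mulr_sumr; apply: ler_sum => i _; rewrite -expRD ler_expR.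
by have := ler_wpM2l (ltW lambda_gt0) (cc' i); lra.
Qed.

(** Each of the [k] summands is at most [expR (lambda * max_affine p z c)], hence a factor [k] under
    the root. *)
Lemma soft_max_affine_le z c : soft_max_affine lambda p z c <=
  k%:R `^ lambda^-1 * expR (max_affine p z c).
Proof.
rewrite -expR_root -powRM ?expR_ge0//; apply: root_le; first exact: S_ge0.
rewrite -[k in k%:R]card_ord -sum1_card natr_sum mulr_suml.
apply: ler_sum => i _; rewrite mul1r ler_expR -mulrDr ler_pM2l//.
exact: max_affine_ge.
Qed.

Lemma soft_max_affine_midpoint (i0 : 'I_k) z c c' :
  soft_max_affine lambda p z (2^-1 *: (c + c')) ^+ 2 <=
  soft_max_affine lambda p z c * soft_max_affine lambda p z c' /\
  (soft_max_affine lambda p z c * soft_max_affine lambda p z c' <=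
   soft_max_affine lambda p z (2^-1 *: (c + c')) ^+ 2 ->
   exists t, c = c' + const_mx t).
Proof.
(* [e c i] is the square root of the [i]-th summand, so the sum at the midpoint is the scalar
   product of [e c] and [e c']. *)
pose e c i := expR (2^-1 * (lambda * dotp z (p i) + lambda * c 0 i)).
have SE c1 : S z c1 = \sum_i e c1 i ^+ 2.
  by apply: eq_bigr => i _; rewrite /e -expRM_natl; congr expR; field.
have midE : S z (2^-1 *: (c + c')) = \sum_i e c i * e c' i.
  by apply: eq_bigr => i _; rewrite /e -expRD; congr expR; rewrite !mxE; field.
have [CS CSeq] := cauchy_schwarz_sum (e c) i0 (fun i => expR_gt0 _ : 0 < e c' i).
move: (CS); rewrite -midE -!SE => CS_S.
have [mid_le mid_eq] := root_sq_le (S_ge0 _ _) (S_ge0 _ _) (S_ge0 _ _) CS_S.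
split=> [|/mid_eq]; first exact: mid_le.
rewrite midE !SE => /eqP; rewrite CSeq.
set t := _ / _; clearbody t => /forallP ce.
have t0 : 0 < t.
  have ec'_gt0 : 0 < e c' i0 := expR_gt0 _.
  by rewrite -(pmulr_lgt0 _ ec'_gt0) -(eqP (ce i0)) expR_gt0.
exists (2 * ln t / lambda); apply/rowP => i; rewrite !mxE.
have /eqP /(congr1 (@ln R)) := ce i.
by rewrite lnM ?posrE ?expR_gt0// /e !expRK => /half_log_eq.
Qed.

End soft_max_affine.

(** * Common properties of the two families of kernels *)

(** Both [expR] of [max_affine] and [soft_max_affine] qualify, so the dual objective is analysed
    once for the two. Growth is asked only at 0, since [kernel_shift] carries it to every [c]. *)
Record exponential_kernel (R : realType) (d k : nat) (p : 'I_k -> d.-tuple R)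
    (K : d.-tuple R -> 'rV[R]_k -> R) : Prop := ExponentialKernel {
  kernel_measurable : forall c, measurable_fun setT (fun z => K z c);
  kernel_ge : forall z (c : 'rV[R]_k) i, expR (dotp z (p i) + c 0 i) <= K z c;
  kernel_shift : forall z (c c' : 'rV[R]_k) r,
    (forall i, c 0 i <= c' 0 i + r) -> K z c <= expR r * K z c';
  kernel_growth : exists C, forall z, K z 0 <= C * expR (2^-1 * dotp z z)
}.

Lemma max_affine_kernel (R : realType) (d k : nat) (p : 'I_k -> d.-tuple R)
    (i0 : 'I_k) :
  exponential_kernel p (fun z c => expR (max_affine p z c)).
Proof.
split.
- by move=> c; apply: measurableT_comp => //; exact: measurable_max_affine.
- by move=> z c i; rewrite ler_expR max_affine_ge.
- move=> z c c' r cc'; rewrite -expRD ler_expR; apply: (max_affine_le i0) => i.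
  by have := max_affine_ge p z c' i; have := cc' i; lra.
- exists (\sum_i expR (2^-1 * dotp (p i) (p i))) => z.
  exact: expR_max_affine0_le.
Qed.

Lemma soft_max_affine_kernel (R : realType) (d k : nat)
    (p : 'I_k -> d.-tuple R) (i0 : 'I_k) (lambda : R) : 0 < lambda ->
  exponential_kernel p (soft_max_affine lambda p).
Proof.
move=> lambda0; split.
- exact: measurable_soft_max_affine.
- exact: expR_le_soft_max_affine.
- exact: soft_max_affine_shift.
- exists (k%:R `^ lambda^-1 * \sum_i expR (2^-1 * dotp (p i) (p i))) => z.
  apply: le_trans (soft_max_affine_le _ _ _ _) _ => //.
  by rewrite -mulrA ler_wpM2l ?powR_ge0// expR_max_affine0_le.
Qed.

(** * Weighted sums, coordinates and the oplus relation *)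

(** [M] minus the average is [\sum_k w_k (M - t_k)], a sum of nonnegative terms of which only the
    one at [i] is kept. *)
Lemma weighted_sum_le (R : realDomainType) (I : finType) (w t : I -> R) (M : R)
    (i : I) : (forall k, 0 <= w k) -> \sum_k w k = 1 -> (forall k, t k <= M) ->
  \sum_k w k * t k <= M - w i * (M - t i).
Proof.
move=> w0 w1 tM; rewrite -subr_ge0.
have -> : M - w i * (M - t i) - \sum_k w k * t k =
    \sum_k w k * (M - t k) - w i * (M - t i).
  under [in RHS]eq_bigr do rewrite mulrBr.
  by rewrite sumrB -mulr_suml w1; ring.
rewrite (bigD1 i) //= [X in X - _]addrC addrK; apply: sumr_ge0 => k _.
by rewrite mulr_ge0 ?subr_ge0.
Qed.

Lemma coord_le_sum (R : realDomainType) k (c : 'rV[R]_k) i : c 0 i <= \sum_j `|c 0 j|.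
Proof.
by rewrite (bigD1 i) //= (le_trans (ler_norm _))// lerDl sumr_ge0.
Qed.

Lemma continuous_sum_coord (R : realType) (T : topologicalType) k
    (w u : 'I_k -> R) (f : T -> 'rV[R]_k) :
  continuous f -> continuous (fun t => \sum_i w i * (f t 0 i + u i)).
Proof.
move=> cf; elim: (index_enum _) => [|i s ihs].
  under eq_fun do rewrite big_nil; exact: cst_continuous.
under eq_fun do rewrite big_cons; move=> t; apply: cvgD; last exact: ihs.
apply: cvgM; first exact: cvg_cst.
apply: cvgD; last exact: cvg_cst.
by apply: (@continuous_comp _ _ _ f (fun c : 'rV[R]_k => c 0 i));
  [exact: cf|exact: coord_continuous].
Qed.

Lemma near_coord (R : realType) k (c : 'rV[R]_k) (e : R) : 0 < e ->
  nbhs c [set c' : 'rV[R]_k | forall i, `|c 0 i - c' 0 i| <= e].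
Proof.
move=> e0; apply: (@filter_forall _ _
  (fun i (c' : 'rV[R]_k) => `|c 0 i - c' 0 i| <= e) (nbhs c) _) => i.
exact: (cvgr_dist_le _ _ (@coord_continuous R 1 k 0 i c)).
Qed.

Section oplus_equiv.
Context {R : realType} {n m : nat}.
Implicit Types p q : 'rV[R]_n * 'rV[R]_m.

Lemma oplus_equiv_sym p q : oplus_equiv p q -> oplus_equiv q p.
Proof.
by move=> [r [p1 p2]]; exists (- r); rewrite p1 p2; split;
  apply/rowP => i; rewrite !mxE; ring.
Qed.

Lemma oplus_equiv_refl p : oplus_equiv p p.
Proof. by exists 0; split; apply/rowP => i; rewrite !mxE; ring. Qed.

Lemma oplus_equiv_pair p q i j : oplus_equiv p q ->
  p.1 0 i + p.2 0 j = q.1 0 i + q.2 0 j.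
Proof. by move=> [r [-> ->]]; rewrite !mxE; ring. Qed.

End oplus_equiv.

(** * Coercivity, continuity and maximizers of the objective *)

Section kernel_objective.
Context {R : realType} {d n m : nat}.
Variables (a : 'I_n -> R) (b : 'I_m -> R).
Variables (x : 'I_n -> d.-tuple R) (y : 'I_m -> d.-tuple R).
Variable gamma : probability (d.-tuple R * d.-tuple R)%type R.
Hypotheses (a_gt0 : forall i, 0 < a i) (b_gt0 : forall j, 0 < b j).
Hypotheses (a_sum1 : \sum_(i < n) a i = 1) (b_sum1 : \sum_(j < m) b j = 1).
Variables (i0 : 'I_n) (j0 : 'I_m).
Local Notation mu := (gauss_reweight gamma).
Variables (K1 : d.-tuple R -> 'rV[R]_n -> R) (K2 : d.-tuple R -> 'rV[R]_m -> R).
Hypotheses (kK1 : exponential_kernel x K1) (kK2 : exponential_kernel y K2).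
Implicit Types p q : 'rV[R]_n * 'rV[R]_m.

Definition kernel_mass p : R := \int[mu]_z (K1 z.1 p.1 * K2 z.2 p.2).

Definition kernel_obj p : R := linear_part a b x y p - kernel_mass p + 1.

Lemma kernel1_gt0 z c : 0 < K1 z c.
Proof. exact: lt_le_trans (expR_gt0 _) (kernel_ge kK1 z c i0). Qed.

Lemma kernel2_gt0 z c : 0 < K2 z c.
Proof. exact: lt_le_trans (expR_gt0 _) (kernel_ge kK2 z c j0). Qed.

Lemma kernel_prod_gt0 (z : d.-tuple R * d.-tuple R) p : 0 < K1 z.1 p.1 * K2 z.2 p.2.
Proof. by rewrite mulr_gt0 ?kernel1_gt0 ?kernel2_gt0. Qed.

Lemma measurable_kernel_prod p :
  measurable_fun setT (fun z : d.-tuple R * d.-tuple R => K1 z.1 p.1 * K2 z.2 p.2).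
Proof.
apply: measurable_funM.
  exact: (measurableT_comp (kernel_measurable kK1 p.1) measurable_fst).
exact: (measurableT_comp (kernel_measurable kK2 p.2) measurable_snd).
Qed.

(** [kernel_shift] reduces to [c = 0] at the price of the l1 norms [r] and [s]; the quadratic
    exponentials of [kernel_growth] then cancel exactly against the weight. *)
Lemma kernel_prod_integrable p :
  mu.-integrable setT (EFin \o (fun z => K1 z.1 p.1 * K2 z.2 p.2)).
Proof.
have [C1 growth1] := kernel_growth kK1; have [C2 growth2] := kernel_growth kK2.
pose r := \sum_i `|p.1 0 i|; pose s := \sum_j `|p.2 0 j|.
have le1 z : K1 z p.1 <= expR r * (C1 * expR (2^-1 * dotp z z)).
  apply: (@le_trans _ _ (expR r * K1 z 0)); last by rewrite ler_pM2l ?expR_gt0.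
  by apply: (kernel_shift kK1) => i; rewrite mxE add0r coord_le_sum.
have le2 z : K2 z p.2 <= expR s * (C2 * expR (2^-1 * dotp z z)).
  apply: (@le_trans _ _ (expR s * K2 z 0)); last by rewrite ler_pM2l ?expR_gt0.
  by apply: (kernel_shift kK2) => i; rewrite mxE add0r coord_le_sum.
apply: (@gauss_reweight_integrable _ _ _ _ (expR r * C1 * (expR s * C2))).
- exact: measurable_kernel_prod.
- by move=> z; exact/ltW/kernel_prod_gt0.
move=> z; have le12 := ler_pM (ltW (kernel1_gt0 _ _)) (ltW (kernel2_gt0 _ _))
  (le1 z.1) (le2 z.2).
apply: le_trans (ler_wpM2r (expR_ge0 _) le12) _.
rewrite /gauss_weight expRD !expRN.
by rewrite le_eqVlt; apply/orP; left; apply/eqP; field; rewrite !gt_eqF ?expR_gt0.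
Qed.

Lemma kernel_mass_gt0 p : 0 < kernel_mass p.
Proof.
apply: Rintegral_gt0; first exact: gauss_reweight_neq0.
  exact: kernel_prod_integrable.
by move=> z; exact: kernel_prod_gt0.
Qed.

(** This estimate yields both invariance under the oplus relation ([r + s = 0]) and continuity ([r]
    and [s] small). *)
Lemma kernel_mass_shift p q (r s : R) :
  (forall i, p.1 0 i <= q.1 0 i + r) -> (forall j, p.2 0 j <= q.2 0 j + s) ->
  kernel_mass p <= expR (r + s) * kernel_mass q.
Proof.
move=> pq1 pq2; have iq := kernel_prod_integrable q.
rewrite /kernel_mass -RintegralZl//; apply: le_Rintegral => //.
- exact: kernel_prod_integrable.
- by apply: (integrableZl measurableT (expR (r + s)) iq).
move=> z _; rewrite expRD mulrACA.
apply: ler_pM; rewrite ?(ltW (kernel1_gt0 _ _)) ?(ltW (kernel2_gt0 _ _))//.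
- exact: (kernel_shift kK1).
- exact: (kernel_shift kK2).
Qed.

(** Both weight families sum to 1, so the linear part depends only on the pairwise sums, averaged by
    the product coupling. *)
Lemma linear_partE p : linear_part a b x y p =
  linear_part a b x y 0 + \sum_i \sum_j a i * b j * (p.1 0 i + p.2 0 j).
Proof.
have -> : \sum_i \sum_j a i * b j * (p.1 0 i + p.2 0 j) =
    \sum_i a i * p.1 0 i + \sum_j b j * p.2 0 j.
  under eq_bigr => i _.
    under eq_bigr do rewrite mulrDr -!mulrA [b _ * p.1 _ _]mulrC.
    rewrite big_split /=.
    rewrite -mulr_sumr -mulr_sumr b_sum1 mulr1 -mulr_sumr. over.
  by rewrite big_split /= -mulr_suml a_sum1 mul1r.
rewrite /linear_part addrACA -!big_split /=.
by congr (_ + _); apply: eq_bigr => i _; rewrite mxE; ring.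
Qed.

Lemma kernel_obj_oplus p q : oplus_equiv p q -> kernel_obj p = kernel_obj q.
Proof.
have mass_le p1 p2 : oplus_equiv p1 p2 -> kernel_mass p1 <= kernel_mass p2.
  move=> [r [e1 e2]]; have := @kernel_mass_shift p1 p2 r (- r).
  by rewrite subrr expR0 mul1r; apply => i; rewrite (e1, e2) !mxE.
move=> pq; rewrite /kernel_obj (linear_partE p) (linear_partE q).
under eq_bigr do under eq_bigr do rewrite (oplus_equiv_pair _ _ pq).
congr (_ - _ + 1); apply/le_anti.
by rewrite (mass_le _ _ pq) (mass_le _ _ (oplus_equiv_sym pq)).
Qed.

(** By [kernel_ge] one exponential is kept from each kernel; [c] is the integral of the factor free
    of [p]. *)
Lemma kernel_mass_ge i j :
  exists2 c, 0 < c & forall p, c * expR (p.1 0 i + p.2 0 j) <= kernel_mass p.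
Proof.
pose h (z : d.-tuple R * d.-tuple R) := expR (dotp z.1 (x i) + dotp z.2 (y j)).
have ih : mu.-integrable setT (EFin \o h).
  apply: (@gauss_reweight_integrable _ _ _ _
      (expR (2^-1 * dotp (x i) (x i) + 2^-1 * dotp (y j) (y j)))).
  - apply: measurableT_comp => //.
    by apply: measurable_funD; exact: measurable_dotp.
  - by move=> z; exact: expR_ge0.
  - move=> z; rewrite /h /gauss_weight -expRD ler_expR.
    by have := dotp_le z.1 (x i); have := dotp_le z.2 (y j); lra.
exists (\int[mu]_z h z).
  by apply: Rintegral_gt0 => [|//|z]; [exact: gauss_reweight_neq0|exact: expR_gt0].
move=> p; rewrite -RintegralZr//; apply: le_Rintegral => //.
- by apply: (integrableZr measurableT (expR _) ih).
- exact: kernel_prod_integrable.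
move=> z _; rewrite /h -expRD addrACA expRD.
by apply: ler_pM; rewrite ?expR_ge0//; [exact: (kernel_ge kK1)|exact: (kernel_ge kK2)].
Qed.

(* With M the logarithm of the mass, every pairwise sum is at most M + O(1),
   so the objective is at most O(1) + M - expR M - w (M - t) for every pair. *)
Lemma kernel_obj_coercive (K0 : R) : exists B : 'I_n -> 'I_m -> R,
  forall p, K0 <= kernel_obj p -> forall i j, `|p.1 0 i + p.2 0 j| <= B i j.
Proof.
have [c c_gt0 mass_ge] : exists2 c : 'I_n * 'I_m -> R, (forall ij, 0 < c ij) &
    forall ij p, c ij * expR (p.1 0 ij.1 + p.2 0 ij.2) <= kernel_mass p.
  have /choice[c hc] : forall ij : 'I_n * 'I_m, exists c, 0 < c /\
      forall p, c * expR (p.1 0 ij.1 + p.2 0 ij.2) <= kernel_mass p.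
    by move=> [i j]; have [c c0 hc] := kernel_mass_ge i j; exists c.
  by exists c => ij; have [] := hc ij.
pose w (ij : 'I_n * 'I_m) := a ij.1 * b ij.2.
have w_gt0 ij : 0 < w ij by rewrite mulr_gt0.
have w_sum : \sum_ij w ij = 1.
  rewrite -(pair_bigA _ (fun i j => a i * b j)) /=.
  by under eq_bigr do rewrite -mulr_sumr b_sum1 mulr1.
have w_le1 ij : w ij <= 1.
  by rewrite -w_sum (bigD1 ij) //= lerDl sumr_ge0// => kl _; exact: ltW.
(* [C] gathers the constants left when the pairwise sums are rewritten through [t]; [D] will bound
   [M] from above and [E] will bound [t] from below. *)
pose C := linear_part a b x y 0 + 1 - \sum_ij w ij * ln (c ij).
pose D := C + 2 * ln 2 - 2 - K0.
pose E ij := (K0 - C - (1 - w ij) * D) / w ij.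
exists (fun i j => `|ln (c (i, j))| + `|D| + `|E (i, j)|) => p K0p i j.
pose M := ln (kernel_mass p).
have expM : expR M = kernel_mass p by rewrite lnK ?posrE ?kernel_mass_gt0.
pose t (ij : 'I_n * 'I_m) := p.1 0 ij.1 + p.2 0 ij.2 + ln (c ij).
have t_le ij : t ij <= M.
  by rewrite -ler_expR expM expRD lnK ?posrE// mulrC.
have objE : kernel_obj p = C + \sum_ij w ij * t ij - expR M.
  rewrite /kernel_obj linear_partE expM.
  rewrite (pair_bigA _ (fun i j => a i * b j * (p.1 0 i + p.2 0 j))) /=.
  under [\sum_ij w ij * t ij]eq_bigr do rewrite mulrDr.
  by rewrite big_split /= /C; ring.
have sum_le := weighted_sum_le (i, j) (fun ij => ltW (w_gt0 ij)) w_sum t_le.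
(* The tangent to [expR] at [ln 2] has slope 2, which beats the slope 1 of [M] in the upper
   bound. *)
have M_exp : 2 * (1 + (M - ln 2)) <= expR M.
  rewrite -[in leRHS](subrK (ln 2) M) expRD lnK ?posrE// mulrC.
  by rewrite ler_pM2r// expR_ge1Dx.
have wt := w_gt0 (i, j); have w1 := w_le1 (i, j); have tM := t_le (i, j).
have exp0 := expR_gt0 M.
have wtM : 0 <= w (i, j) * (M - t (i, j)) by rewrite mulr_ge0 ?subr_ge0// ltW.
have M_le : M <= D by rewrite /D; lra.
have E_le : E (i, j) <= t (i, j).
  rewrite ler_pdivrMr//.
  have : (1 - w (i, j)) * M <= (1 - w (i, j)) * D by rewrite ler_wpM2l ?subr_ge0.
  by lra.
have -> : p.1 0 i + p.2 0 j = t (i, j) - ln (c (i, j)) by rewrite /t /= addrK.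
have := ler_norm (ln (c (i, j))); have := ler_norm (- ln (c (i, j))).
have := ler_norm D; have := ler_norm (- E (i, j)); rewrite !normrN.
have := normr_ge0 D; have := normr_ge0 (E (i, j)).
by rewrite ler_norml; lra.
Qed.

(** Moving both blocks by at most [e / 2] changes the logarithm of the mass by at most [e]; [expR]
    then restores the mass. *)
Lemma continuous_kernel_mass : continuous kernel_mass.
Proof.
have cln : continuous (fun p => ln (kernel_mass p)).
  move=> p; apply/cvgrPdist_le => e e0; have e20 : 0 < e / 2 by rewrite divr_gt0.
  have near1 : nbhs p [set q : 'rV[R]_n * 'rV[R]_m |
      forall i, `|p.1 0 i - q.1 0 i| <= e / 2].
    exact: (@cvg_fst _ _ (nbhs p.1) (nbhs p.2) _ _ (near_coord p.1 e20)).
  have near2 : nbhs p [set q : 'rV[R]_n * 'rV[R]_m |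
      forall j, `|p.2 0 j - q.2 0 j| <= e / 2].
    exact: (@cvg_snd _ _ (nbhs p.1) (nbhs p.2) _ _ (near_coord p.2 e20)).
  have ln_le p1 p2 : (forall i, `|p1.1 0 i - p2.1 0 i| <= e / 2) ->
      (forall j, `|p1.2 0 j - p2.2 0 j| <= e / 2) ->
      ln (kernel_mass p1) <= e + ln (kernel_mass p2).
    move=> c1 c2; rewrite -[e in leRHS]expRK -lnM ?posrE ?expR_gt0 ?kernel_mass_gt0//.
    rewrite ler_ln ?posrE ?mulr_gt0 ?expR_gt0 ?kernel_mass_gt0//.
    rewrite [e in leRHS](splitr e); apply: kernel_mass_shift => k.
    - by have := c1 k; rewrite ler_norml => /andP[_]; lra.
    - by have := c2 k; rewrite ler_norml => /andP[_]; lra.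
  near=> q.
  have q1 : forall i, `|p.1 0 i - q.1 0 i| <= e / 2 by near: q.
  have q2 : forall j, `|p.2 0 j - q.2 0 j| <= e / 2 by near: q.
  have pq := ln_le _ _ q1 q2.
  have qp : ln (kernel_mass q) <= e + ln (kernel_mass p).
    by apply: ln_le => k; rewrite distrC.
  by rewrite ler_norml; lra.
rewrite (_ : kernel_mass = expR \o (fun p => ln (kernel_mass p))); last first.
  by apply/funext => p /=; rewrite lnK ?posrE ?kernel_mass_gt0.
by move=> p; apply: continuous_comp; [exact: cln|exact: continuous_expR].
Unshelve. all: by end_near. Qed.

Lemma continuous_kernel_obj : continuous kernel_obj.
Proof.
move=> p; apply: cvgD; last exact: cvg_cst.
apply: cvgB; last exact: continuous_kernel_mass.
apply: cvgD.
- by apply: continuous_sum_coord => q; exact: cvg_fst.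
- by apply: continuous_sum_coord => q; exact: cvg_snd.
Qed.

(** A nonempty superlevel set is unbounded along the oplus relation; compactness is obtained for
    representatives whose first block vanishes at [i0]. *)
Lemma kernel_obj_superlevel_compact (K0 : R) :
  exists2 A : set ('rV[R]_n * 'rV[R]_m), compact A &
    forall q, K0 <= kernel_obj q -> exists2 q', A q' & oplus_equiv q' q.
Proof.
(* After normalization the second block consists of sums with [i0], and the first of differences of
   two sums through [j0], whence the two constants in [A1]. *)
have [B hB] := kernel_obj_coercive K0.
pose A1 i := `[- (B i j0 + B i0 j0), B i j0 + B i0 j0]%classic : set R.
pose A2 j := `[- B i0 j, B i0 j]%classic : set R.
exists ([set c : 'rV[R]_n | forall i, A1 i (c 0 i)] `*`
        [set c : 'rV[R]_m | forall j, A2 j (c 0 j)]).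
  by apply: compact_setX; apply: rV_compact => i; exact: segment_compact.
move=> q K0q; have {}hB := hB q K0q.
exists (q.1 - const_mx (q.1 0 i0), q.2 + const_mx (q.1 0 i0)); last first.
  by exists (- q.1 0 i0); split; apply/rowP => i; rewrite !mxE; ring.
split => /= [i|j]; rewrite /A1 /A2 /= in_itv /= !mxE.
- by have := hB i j0; have := hB i0 j0; rewrite !ler_norml; lra.
- by have := hB i0 j; rewrite !ler_norml; lra.
Qed.

(** Taking the value at 0 as level makes the compact set nonempty; points below that level cannot
    compete. *)
Lemma kernel_obj_maximizer : exists p, is_maximizer kernel_obj p.
Proof.
have [A cA hA] := kernel_obj_superlevel_compact (kernel_obj 0).
have [|r /set_mem Ar rmax] := compact_EVT_max _ cA
  (continuous_subspaceT continuous_kernel_obj).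
  by have [q' Aq' _] := hA 0 (lexx _); exists q'.
exists r => q; have [q0|q0] := leP (kernel_obj 0) (kernel_obj q).
  have [q' Aq' /kernel_obj_oplus <-] := hA q q0.
  exact/rmax/mem_set.
apply: le_trans (ltW q0) _; have [q' Aq' /kernel_obj_oplus <-] := hA 0 (lexx _).
exact/rmax/mem_set.
Qed.

(** Among compact representatives at distance at least [e], the largest value stays strictly below
    the one at [pstar]; this gap gives [eta]. *)
Lemma kernel_obj_well_posed pstar i j (e : R) : 0 < e ->
  is_unique_maximizer kernel_obj pstar ->
  exists2 eta, 0 < eta & forall q, kernel_obj pstar - eta < kernel_obj q ->
    `|q.1 0 i + q.2 0 j - (pstar.1 0 i + pstar.2 0 j)| < e.
Proof.
move=> e0 pmax; have pstar_max := (pmax pstar).2 (oplus_equiv_refl _).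
have [A cA hA] := kernel_obj_superlevel_compact (kernel_obj pstar - 1).
pose g q := `|q.1 0 i + q.2 0 j - (pstar.1 0 i + pstar.2 0 j)|.
have cg : continuous g.
  move=> q; apply: cvg_norm; apply: cvgB; last exact: cvg_cst.
  apply: cvgD.
    by apply: (@continuous_comp _ _ _ fst (fun c : 'rV[R]_n => c 0 i));
      [exact: cvg_fst|exact: coord_continuous].
  by apply: (@continuous_comp _ _ _ snd (fun c : 'rV[R]_m => c 0 j));
    [exact: cvg_snd|exact: coord_continuous].
pose A' := A `&` g @^-1` [set r | e <= r].
have cA' : compact A'.
  apply: compact_closedI => //; apply: preimage_closed; last exact: closed_ge.
  by move=> q _; exact: cg.
have gA' q : kernel_obj pstar - 1 <= kernel_obj q -> e <= g q ->
    exists2 q', A' q' & kernel_obj q' = kernel_obj q.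
  move=> /hA[q' Aq' q'q] eg; exists q'; last exact: kernel_obj_oplus.
  by split => //; rewrite /= /g (oplus_equiv_pair _ _ q'q).
have [A'0|A'0] := pselect (A' !=set0); last first.
  exists 1 => // q /ltW objq; rewrite -/(g q) ltNge; apply/negP => eg.
  by have [q' A'q' _] := gA' q objq eg; apply: A'0; exists q'.
have [r /set_mem [_ er] rmax] := compact_EVT_max A'0 cA'
  (continuous_subspaceT continuous_kernel_obj).
have r_lt : kernel_obj r < kernel_obj pstar.
  rewrite ltNge; apply/negP => le_r.
  have /pmax /oplus_equiv_pair rE : is_maximizer kernel_obj r.
    by move=> q; exact: le_trans (pstar_max q) le_r.
  by move: er; rewrite /= /g rE subrr normr0 leNgt e0.
(* The minimum with 1 keeps [q] above the level that defines the compact set. *)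
exists (Num.min 1 (kernel_obj pstar - kernel_obj r)).
  by rewrite lt_min ltr01 subr_gt0.
move=> q; rewrite ltrBlDl -ltrBlDr lt_min => /andP[q1 qr].
rewrite -/(g q) ltNge; apply/negP => eg.
have [|q' A'q' q'q] := gA' q _ eg; first by lra.
by have := rmax q' (mem_set A'q'); lra.
Qed.

End kernel_objective.

(** * Strict convexity modulo shifts, comparison of masses, uniqueness *)

(** [m1], [m2] stand for values at a midpoint, [X], [Y] for those at its endpoints. With [P = X1 X2]
    and [Q = Y1 Y2], the chain [((P + Q) / 2)^2 <= (m1 m2)^2 <= P Q] reverses the
    arithmetic-geometric inequality, so equality holds throughout. *)
Lemma log_convex_equality (R : realFieldType) (m1 m2 X1 Y1 X2 Y2 : R) :
  0 < m1 -> 0 < m2 -> 0 < X1 -> 0 < Y1 -> 0 < X2 -> 0 < Y2 ->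
  m1 ^+ 2 <= X1 * Y1 -> m2 ^+ 2 <= X2 * Y2 ->
  2^-1 * (X1 * X2 + Y1 * Y2) <= m1 * m2 ->
  [/\ X1 * Y1 <= m1 ^+ 2, X2 * Y2 <= m2 ^+ 2 & X1 * X2 = Y1 * Y2].
Proof.
move=> m1_gt0 m2_gt0 X1_gt0 Y1_gt0 X2_gt0 Y2_gt0 le1 le2 ge_mid.
have P_gt0 := mulr_gt0 X1_gt0 X2_gt0; have Q_gt0 := mulr_gt0 Y1_gt0 Y2_gt0.
have PQE : X1 * X2 * (Y1 * Y2) = X1 * Y1 * (X2 * Y2) by rewrite mulrACA.
have XY1_gt0 := mulr_gt0 X1_gt0 Y1_gt0; have XY2_gt0 := mulr_gt0 X2_gt0 Y2_gt0.
move: (X1 * X2) (Y1 * Y2) (X1 * Y1) (X2 * Y2)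
  P_gt0 Q_gt0 XY1_gt0 XY2_gt0 PQE le1 le2 ge_mid.
move=> P Q U V P_gt0 Q_gt0 U_gt0 V_gt0 PQE le1 le2 ge_mid.
have sq_mid : (2^-1 * (P + Q)) ^+ 2 <= m1 ^+ 2 * m2 ^+ 2.
  rewrite -exprMn ler_sqr ?nnegrE//; last by rewrite mulr_ge0 ?ltW.
  by rewrite mulr_ge0 ?addr_ge0 ?ltW.
have sq_le : m1 ^+ 2 * m2 ^+ 2 <= U * V by apply: ler_pM; rewrite ?sqr_ge0.
have PQ : P = Q.
  have : (P - Q) ^+ 2 <= 0.
    have -> : (P - Q) ^+ 2 = 4 * ((2^-1 * (P + Q)) ^+ 2 - P * Q) by field.
    by rewrite PQE; lra.
  by rewrite le_eqVlt sqrf_eq0 subr_eq0 ltNge sqr_ge0 orbF => /eqP.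
have UV_le : U * V <= m1 ^+ 2 * m2 ^+ 2.
  apply: le_trans sq_mid; rewrite -PQE PQ.
  by rewrite le_eqVlt; apply/orP; left; apply/eqP; field.
split => //.
- rewrite -(ler_pM2r V_gt0); apply: le_trans UV_le _.
  by rewrite ler_wpM2l ?sqr_ge0.
- rewrite -(ler_pM2l U_gt0); apply: le_trans UV_le _.
  by rewrite ler_wpM2r ?sqr_ge0.
Qed.

(** Serves in both directions between hard and soft kernels: with constants 1, then with the roots
    of [n] and [m]. *)
Lemma kernel_mass_le (R : realType) (d n m : nat)
    (x : 'I_n -> d.-tuple R) (y : 'I_m -> d.-tuple R)
    (gamma : probability (d.-tuple R * d.-tuple R)%type R) (i0 : 'I_n) (j0 : 'I_m)
    (K1 K1' : d.-tuple R -> 'rV[R]_n -> R) (K2 K2' : d.-tuple R -> 'rV[R]_m -> R)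
    (c1 c2 : R) p :
  exponential_kernel x K1 -> exponential_kernel y K2 ->
  exponential_kernel x K1' -> exponential_kernel y K2' ->
  (forall z, K1 z p.1 <= c1 * K1' z p.1) -> (forall z, K2 z p.2 <= c2 * K2' z p.2) ->
  kernel_mass gamma K1 K2 p <= c1 * c2 * kernel_mass gamma K1' K2' p.
Proof.
move=> kK1 kK2 kK1' kK2' le1 le2.
have i' := kernel_prod_integrable gamma i0 j0 kK1' kK2' p.
rewrite /kernel_mass -RintegralZl//; apply: le_Rintegral => //.
- exact: (kernel_prod_integrable gamma i0 j0 kK1 kK2).
- by apply: (integrableZl measurableT (c1 * c2) i').
move=> z _; rewrite mulrACA; apply: ler_pM => //.
- exact/ltW/(kernel1_gt0 i0 kK1).
- exact/ltW/(kernel2_gt0 j0 kK2).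
Qed.

Lemma dual_objE (R : realType) (d n m : nat) (a : 'I_n -> R) (b : 'I_m -> R)
    (x : 'I_n -> d.-tuple R) (y : 'I_m -> d.-tuple R)
    (gamma : probability (d.-tuple R * d.-tuple R)%type R) :
  dual_obj a b x y gamma = kernel_obj a b x y gamma
    (fun z c => expR (max_affine x z c)) (fun z c => expR (max_affine y z c)).
Proof.
apply/funext => p; rewrite /dual_obj /kernel_obj; congr (_ - _ + _).
by apply: eq_Rintegral => z _; rewrite expRD.
Qed.

Section uniqueness.
Context {R : realType} {d n m : nat}.
Variables (a : 'I_n -> R) (b : 'I_m -> R).
Variables (x : 'I_n -> d.-tuple R) (y : 'I_m -> d.-tuple R).
Variable gamma : probability (d.-tuple R * d.-tuple R)%type R.
Variables (i0 : 'I_n) (j0 : 'I_m) (lambda : R).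
Hypothesis lambda_gt0 : 0 < lambda.
Implicit Types p q : 'rV[R]_n * 'rV[R]_m.

Let kx := soft_max_affine_kernel x i0 lambda_gt0.
Let ky := soft_max_affine_kernel y j0 lambda_gt0.

Lemma soft_max_affine_const k (p : 'I_k -> d.-tuple R) z c (t : R) :
  soft_max_affine lambda p z (c + const_mx t) =
  expR t * soft_max_affine lambda p z c.
Proof.
apply/le_anti/andP; split.
  by apply: soft_max_affine_shift => // i; rewrite !mxE.
rewrite -(ler_pM2l (expR_gt0 (- t))) mulrA -expRD addNr expR0 mul1r.
by apply: soft_max_affine_shift => // i; rewrite !mxE addrK.
Qed.

Definition midpoint p q : 'rV[R]_n * 'rV[R]_m :=
  (2^-1 *: (p.1 + q.1), 2^-1 *: (p.2 + q.2)).

Local Notation phi := (soft_max_affine lambda x).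
Local Notation psi := (soft_max_affine lambda y).

(* Cauchy-Schwarz gives log-convexity of phi psi; equality at the midpoint
   forces p - q to be constant on each block, and then both values differ by
   the factor expR (t + s). *)
Lemma soft_max_affine_prod_midpoint p q z : ~ oplus_equiv p q ->
  phi z.1 (midpoint p q).1 * psi z.2 (midpoint p q).2 <
  2^-1 * (phi z.1 p.1 * psi z.2 p.2 + phi z.1 q.1 * psi z.2 q.2).
Proof.
move=> npq; rewrite ltNge; apply/negP => ge_mid; apply: npq.
have [le1 eq1] := soft_max_affine_midpoint x lambda_gt0 i0 z.1 p.1 q.1.
have [le2 eq2] := soft_max_affine_midpoint y lambda_gt0 j0 z.2 p.2 q.2.
move: ge_mid le1 eq1 le2 eq2; rewrite /=.
have := kernel1_gt0 i0 kx z.1 p.1; have := kernel1_gt0 i0 kx z.1 q.1.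
have := kernel2_gt0 j0 ky z.2 p.2; have := kernel2_gt0 j0 ky z.2 q.2.
have := kernel1_gt0 i0 kx z.1 (2^-1 *: (p.1 + q.1)).
have := kernel2_gt0 j0 ky z.2 (2^-1 *: (p.2 + q.2)).
set m1 := phi _ (_ *: _); set m2 := psi _ (_ *: _).
set X1 := phi _ p.1; set Y1 := phi _ q.1; set X2 := psi _ p.2; set Y2 := psi _ q.2.
move=> m2_gt0 m1_gt0 Y2_gt0 X2_gt0 Y1_gt0 X1_gt0 ge_mid le1 eq1 le2 eq2.
have [ge1 ge2 PQ] := log_convex_equality m1_gt0 m2_gt0
  X1_gt0 Y1_gt0 X2_gt0 Y2_gt0 le1 le2 ge_mid.
have [t pt] := eq1 ge1; have [s ps] := eq2 ge2.
have ts0 : t + s = 0.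
  apply: expR_inj; rewrite expR0; apply: (mulIf (lt0r_neq0 (mulr_gt0 Y1_gt0 Y2_gt0))).
  by rewrite mul1r -[in RHS]PQ /X1 /X2 pt ps !soft_max_affine_const expRD mulrACA.
exists t; split; [exact: pt|rewrite ps]; apply/rowP => j; rewrite !mxE.
by rewrite (addr0_eq ts0).
Qed.

(** The linear part is affine and the integral strictly convex across distinct classes, so the
    midpoint of two inequivalent maximizers would do better. *)
Lemma reg_dual_obj_maximizer_unique p q :
  is_maximizer (reg_dual_obj a b x y gamma lambda) p ->
  is_maximizer (reg_dual_obj a b x y gamma lambda) q -> oplus_equiv p q.
Proof.
move=> pmax qmax; apply: contrapT => npq.
have := pmax (midpoint p q); have := qmax (midpoint p q).
have lin : linear_part a b x y (midpoint p q) =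
    2^-1 * (linear_part a b x y p + linear_part a b x y q).
  rewrite /linear_part addrACA -!big_split /= mulrDr !mulr_sumr.
  by congr (_ + _); apply: eq_bigr => i _; rewrite !mxE; field.
rewrite /reg_dual_obj lin.
have aux (lp lq mp mq mm : R) : 0 < 2^-1 * (mp + mq) - mm ->
    2^-1 * (lp + lq) - mm + 1 <= lq - mq + 1 ->
    2^-1 * (lp + lq) - mm + 1 <= lp - mp + 1 -> False by lra.
have ip := kernel_prod_integrable gamma i0 j0 kx ky.
have ipq := integrableD measurableT (ip p) (ip q).
have ihalf := integrableZl measurableT 2^-1 ipq.
(* The pointwise gap at the midpoint has a positive integral because the measure is nonzero. *)
have := Rintegral_gt0 (gauss_reweight_neq0 gamma)
  (integrableB measurableT ihalf (ip (midpoint p q))) _.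
rewrite /= => /(_ _) gap.
have {gap} : 0 < \int[gauss_reweight gamma]_z
    (2^-1 * (phi z.1 p.1 * psi z.2 p.2 + phi z.1 q.1 * psi z.2 q.2) -
     phi z.1 (midpoint p q).1 * psi z.2 (midpoint p q).2).
  by apply: gap => z; rewrite subr_gt0; exact: soft_max_affine_prod_midpoint.
rewrite RintegralB; [|exact: measurableT|exact: ihalf|exact: ip].
rewrite RintegralZl; [|exact: measurableT|exact: ipq].
rewrite RintegralD; [|exact: measurableT|exact: ip|exact: ip].
exact: aux.
Qed.

End uniqueness.

(** * The limit of large [lambda] *)

(** The power is [expR (ln k / lambda)], whose exponent tends to 0. *)
Lemma root_natr_cvg1 (R : realType) (k : nat) : (0 < k)%N ->
  k%:R `^ lambda^-1 @[lambda --> +oo] --> (1 : R).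
Proof.
move=> k_gt0; have V0 : lambda^-1 @[lambda --> (+oo : set_system R)] --> (0 : R).
  by apply/gtr0_cvgV0; [exact: nbhs_pinfty_gt|exact: cvg_id].
rewrite (_ : (fun lambda => _) = expR \o (fun lambda : R => lambda^-1 * ln k%:R)).
  rewrite -[X in _ --> X]expR0; apply: continuous_cvg; first exact: continuous_expR.
  by rewrite -[X in _ --> X](mul0r (ln k%:R)); apply: cvgMl.
by apply/funext => lambda; rewrite /powR pnatr_eq0 -[_ == _]negbK -lt0n k_gt0.
Qed.

Theorem proposition6p2 (R : realType) (d n m : nat)
    (a : 'I_n -> R) (b : 'I_m -> R)
    (x : 'I_n -> d.-tuple R) (y : 'I_m -> d.-tuple R)
    (gamma : probability (d.-tuple R * d.-tuple R)%type R)
    (a_gt0 : forall i, 0 < a i) (b_gt0 : forall j, 0 < b j)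
    (a_sum1 : \sum_(i < n) a i = 1) (b_sum1 : \sum_(j < m) b j = 1)
    (gamma_ac : gamma `<< (lebesgue_tuple d \x lebesgue_tuple d)%E) :
  (forall lambda : R, 2 < lambda ->
     exists p : 'rV[R]_n * 'rV[R]_m,
       is_unique_maximizer (reg_dual_obj a b x y gamma lambda) p) /\
  (forall (popt : R -> 'rV[R]_n * 'rV[R]_m) (pstar : 'rV[R]_n * 'rV[R]_m),
     (forall lambda : R, 2 < lambda ->
        is_maximizer (reg_dual_obj a b x y gamma lambda) (popt lambda)) ->
     is_unique_maximizer (dual_obj a b x y gamma) pstar ->
     oplus_norm (popt lambda - pstar) @[lambda --> +oo] --> (0 : R)).
Proof.
(* An empty sum is 0, not 1, so both index types are inhabited. *)
have index_of k (w : 'I_k -> R) : \sum_i w i = 1 -> 'I_k.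
  case: k w => [w|k w _]; last exact: ord0.
  by rewrite big_ord0 => /esym/eqP; rewrite oner_eq0.
have i0 := index_of _ _ a_sum1; have j0 := index_of _ _ b_sum1.
split=> [lambda lambda2|popt pstar popt_max pstar_max].
  have lambda_gt0 : 0 < lambda by exact: lt_trans lambda2.
  have kx := soft_max_affine_kernel x i0 lambda_gt0.
  have ky := soft_max_affine_kernel y j0 lambda_gt0.
  have [p pmax] := kernel_obj_maximizer gamma a_gt0 b_gt0 a_sum1 b_sum1 i0 j0 kx ky.
  exists p => q; split => [qmax|qp q']; last first.
    rewrite -[leRHS]/(kernel_obj _ _ _ _ _ _ _ q).
    rewrite (kernel_obj_oplus gamma a_sum1 b_sum1 i0 j0 kx ky qp).
    exact: pmax.
  exact: (reg_dual_obj_maximizer_unique i0 j0 lambda_gt0 qmax pmax).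
pose F := kernel_obj a b x y gamma (fun z c => expR (max_affine x z c))
  (fun z c => expR (max_affine y z c)).
rewrite dual_objE -/F in pstar_max.
have kx := max_affine_kernel x i0; have ky := max_affine_kernel y j0.
pose mass := kernel_mass gamma (fun z c => expR (max_affine x z c))
  (fun z c => expR (max_affine y z c)).
(* [err] bounds the excess of the soft mass over [mass] at [pstar]. *)
pose err (lambda : R) := (n%:R `^ lambda^-1 * m%:R `^ lambda^-1 - 1) * mass pstar.
have F_ge lambda : 2 < lambda -> F pstar - err lambda <= F (popt lambda).
  move=> lambda2; have lambda_gt0 : 0 < lambda by exact: lt_trans lambda2.
  have kxl := soft_max_affine_kernel x i0 lambda_gt0.
  have kyl := soft_max_affine_kernel y j0 lambda_gt0.
  have le_mass p : mass p <= kernel_mass gamma (soft_max_affine lambda x)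
      (soft_max_affine lambda y) p.
    have := @kernel_mass_le _ _ _ _ x y gamma i0 j0 _ _ _ _ 1 1 p kx ky kxl kyl.
    rewrite !mul1r; apply => z; rewrite mul1r.
      by apply: (expR_max_affine_le i0) => i; exact: expR_le_soft_max_affine.
    by apply: (expR_max_affine_le j0) => i; exact: expR_le_soft_max_affine.
  have mass_le : kernel_mass gamma (soft_max_affine lambda x)
      (soft_max_affine lambda y) pstar <=
      n%:R `^ lambda^-1 * m%:R `^ lambda^-1 * mass pstar.
    by apply: (kernel_mass_le gamma i0 j0 kxl kyl kx ky) => z;
      exact: soft_max_affine_le.
  (* The chain of inequalities between the two objectives at [popt lambda] and [pstar], reduced to
     linear arithmetic. *)
  have aux (lp ls mp mlp ms mls c : R) : mp <= mlp -> mls <= c * ms ->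
    ls - mls + 1 <= lp - mlp + 1 ->
    ls - ms + 1 - (c - 1) * ms <= lp - mp + 1 by lra.
  exact: aux (le_mass _) mass_le (popt_max lambda lambda2 pstar).
have err_cvg0 : err lambda @[lambda --> +oo] --> 0.
  rewrite -[X in _ --> X](mul0r (mass pstar)); apply: cvgMl.
  rewrite -[X in _ --> X](subrr 1); apply: cvgB; last exact: cvg_cst.
  rewrite -[X in _ --> X](mulr1 1).
  by apply: cvgM; apply: root_natr_cvg1; exact: leq_ltn_trans (ltn_ord _).
apply/cvgrPdist_lt => e e_gt0.
(* Each pair has its own [eta]; as there are finitely many pairs, a common threshold for [lambda]
   exists. *)
have near_ij i j : \forall lambda \near +oo,
    `|(popt lambda - pstar).1 0 i + (popt lambda - pstar).2 0 j| < e.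
  have [eta eta_gt0 heta] := kernel_obj_well_posed a_gt0 b_gt0 a_sum1 b_sum1
    i0 j0 kx ky i j e_gt0 pstar_max.
  near=> lambda.
  have -> : (popt lambda - pstar).1 0 i + (popt lambda - pstar).2 0 j =
      (popt lambda).1 0 i + (popt lambda).2 0 j - (pstar.1 0 i + pstar.2 0 j).
    by rewrite /= !mxE; ring.
  apply: heta; apply: lt_le_trans (F_ge lambda _); last first.
    by near: lambda; exact: nbhs_pinfty_gt.
  rewrite ltrD2l ltrN2; apply: le_lt_trans (ler_norm _) _.
  by rewrite -normrN -[- err _]add0r; near: lambda; exact: cvgr_dist_lt.
have near_all : \forall lambda \near +oo, forall i j,
    `|(popt lambda - pstar).1 0 i + (popt lambda - pstar).2 0 j| < e.
  by apply: filter_forall => i; apply: filter_forall => j; exact: near_ij.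
apply: filterS near_all => lambda near_lambda.
rewrite sub0r normrN ger0_norm; last exact: bigmax_ge_id.
(* The maxima start from 0, so the strict bound also uses [0 < e]. *)
by rewrite /oplus_norm; apply: bigmax_lt => // i _; apply: bigmax_lt.
Unshelve. all: by end_near. Qed.
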